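(* Let $u=u_1u_2\ldots u_n\in\mathbb{P}^*$ have an increasing/decreasing factorization. For $1\le i\le n-1$ let $s_i=u_{i+1}u_{i+2}\ldots u_n$ and $d_i=d_i(u)$, and let $s_n=\varepsilon$ (the empty word) and $d_n=0$. Then $$S(u;t,x)=\frac{t^{n}x^{\Sigma(u)}}{t^{n}x^{\Sigma(u)}+(1-x-tx)\sum_{i=1}^{n}t^{n-i}x^{d_i+\Sigma(s_i)}(1-x)^{i-1}}.$$
   Context: $\mathbb{P}$ is the set of positive integers with the usual order $\le$, and $\mathbb{P}^*$ is the set of all finite words (including the empty word $\varepsilon$) over $\mathbb{P}$. For $w=w_1\ldots w_n$, $|w|=n$ and $\Sigma(w)=\sum_{i=1}^n w_i$; the weight of $w$ is $\mathrm{wt}(w)=t^{|w|}x^{\Sigma(w)}$. For $u,w\in\mathbb{P}^*$, write $u\le w$ (generalized factor order) if there is a factor $v$ of $w$ (a string of $|u|$ consecutive letters of $w$) with $|v|=|u|$ such that the $i$-th letter of $v$ is $\ge$ the $i$-th letter of $u$ for all $i$; such a $v$ (with its position) is an embedding of $u$ into $w$. $\mathcal{S}(u)$ is the set of words $w$ with $u\le w$ such that the last $|u|$ letters of $w$ form the only embedding of $u$ into $w$, and $S(u;t,x)=\sum_{w\in\mathcal{S}(u)}\mathrm{wt}(w)$. A word $u=u_1\ldots u_n$ has an increasing/decreasing factorization if either $u_1\le\cdots\le u_n$, or there is $k<n$ with $u_1\le\cdots\le u_k>u_{k+1}\ge\cdots\ge u_n$. For $1\le i\le n-1$, $D^{(i)}(u)=\{n-i+j:1\le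 j\le i,\ u_j>u_{n-i+j}\}$ and $d_i(u)=\sum_{n-i+j\in D^{(i)}(u)}(u_j-u_{n-i+j})$. *)

(* Defs.v *)
From HB Require Import structures.
From mathcomp Require Import all_boot all_order all_algebra.
Set Implicit Arguments. Unset Strict Implicit. Unset Printing Implicit Defensive.
Import Order.TTheory GRing.Theory Num.Theory.

(* Words over P are represented as seq nat with all letters positive. *)
Definition posword (w : seq nat) : bool := all (fun a => 0 < a) w.

Definition emb_at (u w : seq nat) (k : nat) : bool :=
  (k + size u <= size w) &&
  all (fun i => nth 0 u i <= nth 0 w (k + i)) (iota 0 (size u)).

Definition gfo (u w : seq nat) : bool :=
  has (emb_at u w) (iota 0 (size w).+1).

Definition inS (u w : seq nat) : bool :=
  gfo u w && emb_at u w (size w - size u) &&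
  all (fun k => (k == size w - size u) || ~~ emb_at u w k) (iota 0 (size w).+1).

Fixpoint allwords (m b : nat) : seq (seq nat) :=
  if m is m'.+1 then
    [seq a :: w | a <- iota 1 b, w <- allwords m' b]
  else [:: [::]].

(* All words in P^* of length m and letter sum s (letters are necessarily <= s). *)
Definition words (m s : nat) : seq (seq nat) :=
  [seq w <- allwords m s | sumn w == s].

(* Coefficient of t^m x^s in S(u;t,x) = #{w in S(u) : |w| = m, Sigma(w) = s}. *)
Definition Scoef (u : seq nat) (m s : nat) : nat := count (inS u) (words m s).

Definition inc_dec (u : seq nat) : Prop :=
  sorted leq u \/
  exists k, [/\ 0 < k < size u, sorted leq (take k u),
             nth 0 u k.-1 > nth 0 u k & sorted geq (drop k u)].

Definition letter (u : seq nat) (j : nat) : nat := nth 0 u j.-1.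

(* d_i(u) = sum over j in 1..i with u_j > u_{n-i+j} of (u_j - u_{n-i+j}).
   For i = n this is 0 automatically (matching the convention d_n = 0). *)
Definition dstat (u : seq nat) (i : nat) : nat :=
  \sum_(1 <= j < i.+1)
     (if letter u (size u - i + j) < letter u j
      then letter u j - letter u (size u - i + j) else 0).

Local Open Scope ring_scope.
Definition tV : {poly {poly int}} := 'X.
Definition xV : {poly {poly int}} := ('X)%:P.

Definition Npoly (u : seq nat) : {poly {poly int}} :=
  tV ^+ size u * xV ^+ sumn u.

(* Denominator; s_i = drop i u (so s_n = empty word). *)
Definition Dpoly (u : seq nat) : {poly {poly int}} :=
  Npoly u + (1 - xV - tV * xV) *
    \sum_(1 <= i < (size u).+1)
       tV ^+ (size u - i) * xV ^+ (dstat u i + sumn (drop i u)) * (1 - xV) ^+ i.-1.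

(* Main.v *)
Require Import Defs.
From HB Require Import structures.
From mathcomp Require Import all_boot all_order all_algebra.
From mathcomp Require Import zify ring.
Set Implicit Arguments. Unset Strict Implicit. Unset Printing Implicit Defensive.
Import GRing.Theory.

(* Let A and S be the generating functions of the words avoiding [u] and of
   S(u), and let A_i, S_i count only those words whose last i letters dominate
   u_1 ... u_i.  Appending a letter to an avoiding word gives either an avoiding
   word or a word of S(u); hence t x A = (1 - x) (A + S - 1), and, requiring the
   new letter to be at least u_(i+1),
   t x^(u_(i+1)) A_i = (1 - x) (A_(i+1) + S_(i+1)).
   As A_n = 0, telescoping expresses A through the S_i.  Finally
   S_i = x^(d_i) S: raise the last i letters of a word of S(u) just enough to
   dominate u_1 ... u_i.  Unimodality of [u] ensures that this creates no new
   embedding.  Eliminating A gives the formula.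

   Series are handled as polynomials compared up to degree M in t and K in x,
   and the words range over the letters 1, ..., K. *)

(** * Embeddings and words extended by one letter *)

Lemma emb_atP u w k :
  reflect (k + size u <= size w /\
           forall i, i < size u -> nth 0 u i <= nth 0 w (k + i))
          (emb_at u w k).
Proof.
apply: (iffP andP) => -[le_k le_uw]; split=> //.
  by move=> i lt_i; apply: (allP le_uw); rewrite mem_iota.
by apply/allP=> i; rewrite mem_iota add0n => /le_uw.
Qed.

Lemma gfoP u w : reflect (exists k, emb_at u w k) (gfo u w).
Proof.
apply: (iffP hasP) => [[k _ uk]|[k uk]]; first by exists k.
exists k => //; rewrite mem_iota add0n ltnS /=.
by have [le_k _] := emb_atP _ _ _ uk; apply: leq_trans le_k; apply: leq_addr.
Qed.

Lemma inSP u w :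
  reflect (emb_at u w (size w - size u) /\
           forall k, emb_at u w k -> k = size w - size u)
          (inS u w).
Proof.
apply: (iffP andP) => [[/andP[_ uw] /allP uniq_w]|[uw uniq_w]].
  split=> // k uk; have [le_k _] := emb_atP _ _ _ uk.
  have /uniq_w : k \in iota 0 (size w).+1 by rewrite mem_iota; lia.
  by rewrite uk orbF => /eqP.
split; first by apply/andP; split=> //; apply/gfoP; exists (size w - size u).
apply/allP=> k _; case uk: (emb_at u w k); last by rewrite orbT.
by rewrite (uniq_w k uk) eqxx.
Qed.

Lemma emb_at_rcons_l u w a k : k + size u <= size w ->
  emb_at u (rcons w a) k = emb_at u w k.
Proof.
move=> le_k; rewrite /emb_at size_rcons le_k leqW //=.
apply: eq_in_all => i; rewrite mem_iota => /andP[_ lt_i].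
by rewrite nth_rcons; case: ltnP => //; lia.
Qed.

Lemma emb_at_rcons_end v c w a :
  emb_at (rcons v c) (rcons w a) (size w - size v) =
  emb_at v w (size w - size v) && (c <= a).
Proof.
(* If [v] is longer than [w], the truncated position is 0 and the length test fails on both
   sides. *)
have [le_v|lt_v] := leqP (size v) (size w); last first.
  by rewrite /emb_at !size_rcons; apply/idP/idP; lia.
apply/emb_atP/andP; rewrite !size_rcons.
  move=> [_ dom]; split.
    apply/emb_atP; split=> [|i lt_i]; first by rewrite subnK.
    have := dom i; rewrite !nth_rcons lt_i.
    have -> : size w - size v + i < size w by lia.
    by apply; lia.
  by have := dom (size v); rewrite !nth_rcons subnK // !ltnn !eqxx; apply.
move=> [/emb_atP[_ dom] le_ca]; split=> [|i]; first by lia.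
rewrite ltnS leq_eqVlt => /predU1P[->|lt_i].
  by rewrite !nth_rcons subnK // !ltnn !eqxx.
have := dom i lt_i; rewrite !nth_rcons lt_i.
by have -> : size w - size v + i < size w by lia.
Qed.

Lemma gfo_rcons u w a : gfo u w -> gfo u (rcons w a).
Proof.
case/gfoP=> k uk; apply/gfoP; exists k.
by rewrite emb_at_rcons_l //; case/emb_atP: uk.
Qed.

(** An embedding into [rcons w a] either lies inside [w] or is the final one, so the final one is
    unique exactly when [w] avoids [u]. *)
Lemma inS_rcons u w a : 0 < size u ->
  inS u (rcons w a) = ~~ gfo u w && gfo u (rcons w a).
Proof.
move=> u_gt0; apply/inSP/andP; rewrite size_rcons.
  move=> [uw uniq_w]; split; last by apply/gfoP; eexists; exact: uw.
  apply/gfoP=> -[k uk]; have [le_k _] := emb_atP _ _ _ uk.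
  have := uniq_w k; rewrite emb_at_rcons_l // => /(_ uk).
  by have := uk; lia.
move=> [no_uw /gfoP[k uk]].
have eq_end k' : emb_at u (rcons w a) k' -> k' = (size w).+1 - size u.
  move=> uk'; have [] := emb_atP _ _ _ uk'; rewrite size_rcons => le_k' _.
  have [le_k|lt_k] := leqP (k' + size u) (size w); last by lia.
  by case/gfoP: no_uw; exists k'; rewrite -(@emb_at_rcons_l u w a).
by split=> //; rewrite -(eq_end k uk).
Qed.

(** A descent from [i] to [j] cannot lie within the increasing part, so [j] is already in the
    decreasing part. *)
Lemma inc_dec_after_descent u i j k : inc_dec u ->
  i < j -> j <= k < size u -> nth 0 u j < nth 0 u i -> nth 0 u k <= nth 0 u j.
Proof.
move=> + lt_ij /andP[le_jk lt_k] desc.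
have sorted_nth s (r : rel nat) a b : reflexive r -> transitive r -> sorted r s ->
    a <= b < size s -> r (nth 0 s a) (nth 0 s b).
  move=> rr rt rs /andP[ab bs].
  by apply: (sorted_leq_nth rt rr) => //; rewrite inE; lia.
case=> [inc|[p [/andP[p_gt0 lt_p] inc _ dec]]].
  by have := sorted_nth u leq i j leqnn leq_trans inc; lia.
have geq_trans : transitive geq by move=> x y z /= yx zy; apply: leq_trans zy yx.
have geq_refl : reflexive geq by move=> x; apply: leqnn.
have [lt_jp|le_pj] := ltnP j p.
  have := sorted_nth (take p u) leq i j leqnn leq_trans inc.
  by rewrite size_take lt_p !nth_take //; lia.
have := sorted_nth (drop p u) geq (j - p) (k - p) geq_refl geq_trans dec.
by rewrite size_drop !nth_drop !subnKC //=; lia.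
Qed.

(** * Enumeration of words by length and sum *)

Lemma mem_allwords m b w :
  (w \in allwords m b) = [&& size w == m, posword w & all (leq^~ b) w].
Proof.
elim: m w => [|m IHm] [|a w] //=.
  by apply/allpairsP => -[[x y] [/= _ _]].
apply/allpairsP/and3P.
  case=> -[x y] /= [+ + [-> ->]]; rewrite mem_iota IHm.
  move=> /andP[x_gt0 x_le] /and3P[/eqP -> -> ->].
  by rewrite eqxx x_gt0; split=> //; lia.
rewrite eqSS => -[sz /andP[a_gt0 pos] /andP[a_le bnd]].
by exists (a, w); rewrite /= mem_iota IHm sz pos bnd; split=> //; lia.
Qed.

Lemma allwords_uniq m b : uniq (allwords m b).
Proof.
elim: m => //= m IHm; apply: allpairs_uniq => //; first exact: iota_uniq.
by move=> [x y] [x' y'] _ _ /= [-> ->].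
Qed.

Lemma letter_le_sumn w : all (leq^~ (sumn w)) w.
Proof.
elim: w => //= a w IHw; rewrite leq_addr /=.
by apply: sub_all IHw => b /= le_b; apply: leq_trans le_b (leq_addl _ _).
Qed.

Lemma mem_words m s w :
  (w \in words m s) = [&& size w == m, posword w & sumn w == s].
Proof.
rewrite mem_filter mem_allwords; case: eqP => [<-|_]; last by rewrite !andbF.
by rewrite letter_le_sumn.
Qed.

Lemma words_uniq m s : uniq (words m s).
Proof. exact/filter_uniq/allwords_uniq. Qed.

(** No letter exceeds the sum of its word. This lets one alphabet 1, ..., [K] serve for all sums up
    to [K] in the series below. *)
Lemma perm_words m s b : s <= b ->
  perm_eq [seq w <- allwords m b | sumn w == s] (words m s).
Proof.
move=> le_sb; apply: uniq_perm; rewrite ?filter_uniq ?allwords_uniq //.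
move=> w; rewrite mem_words mem_filter mem_allwords.
case: eqP => [eq_s|_]; last by rewrite !andbF.
have -> : all (leq^~ b) w.
  apply: sub_all (letter_le_sumn w) => a /= le_a.
  by apply: leq_trans le_a _; rewrite eq_s.
by [].
Qed.

(** * Words whose last letters dominate a prefix of [u] *)

Definition ends_above (u : seq nat) (i : nat) (w : seq nat) : bool :=
  emb_at (take i u) w (size w - i).

Lemma ends_above_rcons u i w a : i < size u ->
  ends_above u i.+1 (rcons w a) = ends_above u i w && (nth 0 u i <= a).
Proof.
move=> lt_i; have sz : size (take i u) = i by rewrite size_take lt_i.
rewrite /ends_above (take_nth 0) // size_rcons subSS.
by have := emb_at_rcons_end (take i u) (nth 0 u i) w a; rewrite sz.
Qed.

Lemma ends_above0 u w : ends_above u 0 w.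
Proof. by rewrite /ends_above take0 subn0; apply/emb_atP; rewrite addn0. Qed.

Lemma ends_above_size u w : ends_above u (size u) w -> gfo u w.
Proof. by rewrite /ends_above take_size => uw; apply/gfoP; eexists; exact: uw. Qed.

Lemma ends_above_nil u i : i < size u -> ends_above u i.+1 [::] = false.
Proof.
move=> lt_i; apply/emb_atP=> -[]; rewrite size_takel //; lia.
Qed.

(** * Raising and lowering the last [i] letters *)

Section Lifting.

Variables (u : seq nat) (i : nat).
Hypothesis le_i : i <= size u.

(* What position [p] of a word of length [m] misses to exceed the prefix of
   [u] of length [i] ending the word, knowing that it exceeds [u] there. *)
Definition deficit (m p : nat) : nat :=
  if p < m - i then 0 else nth 0 u (p - (m - i)) - nth 0 u (p - (m - size u)).

Definition lift_word (w : seq nat) : seq nat :=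
  mkseq (fun p => nth 0 w p + deficit (size w) p) (size w).

Definition lower_word (w : seq nat) : seq nat :=
  mkseq (fun p => nth 0 w p - deficit (size w) p) (size w).

Lemma sum_deficit m : size u <= m -> \sum_(0 <= p < m) deficit m p = dstat u i.
Proof.
move=> le_m; rewrite (@big_cat_nat _ _ _ (m - i)) //=; last by lia.
rewrite big_nat big1 ?add0n; last by move=> p lt_p; rewrite /deficit; case: ltnP; lia.
(* With [p = m - i + j], the final copy of [u] has its letter [size u - i + j] at [p]; truncated
   subtraction plays the part of the test in [dstat]. *)
rewrite /dstat -{1}[m - i]add0n big_addn subKn; last by lia.
rewrite big_add1 /= !big_nat; apply: eq_bigr => j lt_j.
rewrite /deficit /letter addnS /= addnK.
have -> : (j + (m - i) < m - i) = false by lia.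
have -> : j + (m - i) - (m - size u) = size u - i + j by lia.
by case: ltnP => //; lia.
Qed.

Lemma sumn_nth w : sumn w = \sum_(0 <= p < size w) nth 0 w p.
Proof. by rewrite sumnE (big_nth 0). Qed.

Lemma sumn_lift_word w : size u <= size w ->
  sumn (lift_word w) = sumn w + dstat u i.
Proof.
move=> le_w; rewrite !sumn_nth size_mkseq -(sum_deficit le_w) -big_split /=.
by rewrite !big_nat; apply: eq_bigr => p /andP[_ lt_p]; rewrite nth_mkseq.
Qed.

Lemma posword_nth w : reflect (forall p, p < size w -> 0 < nth 0 w p) (posword w).
Proof. exact: all_nthP. Qed.

Lemma nth_lift_word w p : p < size w ->
  nth 0 (lift_word w) p = nth 0 w p + deficit (size w) p.
Proof. by move=> lt_p; rewrite nth_mkseq. Qed.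

Lemma ends_aboveP w :
  reflect (i <= size w /\ forall j, j < i -> nth 0 u j <= nth 0 w (size w - i + j))
          (ends_above u i w).
Proof.
have sz : size (take i u) = i by rewrite size_takel.
apply: (iffP (emb_atP _ _ _)); rewrite sz => -[le_w dom].
  by split=> [|j lt_j]; [lia | have := dom j lt_j; rewrite nth_take].
by split=> [|j lt_j]; [lia | rewrite nth_take //; apply: dom].
Qed.

(* A letter is raised only at a position [p] with [u_j > u_p] for some [j < p];
   from there on [u] decreases, so earlier occurrences of [u] do not benefit
   from the raise. *)
Lemma inS_lift_word w : inc_dec u -> inS u w ->
  inS u (lift_word w) && ends_above u i (lift_word w).
Proof.
move=> idu /inSP[/emb_atP[le_w dom] uniq_w].
have sz : size (lift_word w) = size w by rewrite size_mkseq.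
apply/andP; split; last first.
  apply/ends_aboveP; rewrite sz; split=> [|j lt_j]; first by lia.
  rewrite nth_lift_word; last by lia.
  have := dom (size u - i + j); rewrite /deficit.
  have -> : (size w - i + j < size w - i) = false by lia.
  have -> : size w - i + j - (size w - size u) = size u - i + j by lia.
  have -> : size w - i + j - (size w - i) = j by lia.
  have -> : size w - size u + (size u - i + j) = size w - i + j by lia.
  lia.
apply/inSP; rewrite sz; split.
  apply/emb_atP; rewrite sz; split=> // j lt_j.
  rewrite nth_lift_word; last by lia.
  by have := dom j lt_j; lia.
move=> k /emb_atP[]; rewrite sz => le_k domk; apply: uniq_w.
apply/emb_atP; split=> // j lt_j; have := domk j lt_j.
rewrite nth_lift_word; last by lia.
rewrite /deficit; case: ltnP => [_|ge_kj]; first by rewrite addn0.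
(* The final embedding puts letter [q] of [u] at position [k + j]. As [k] is at most the final
   position, [q <= j], so after a descent to [q] letter [j] of [u] is at most letter [q], hence at
   most the unraised letter. *)
set q := k + j - (size w - size u).
have [le_q|lt_q] := leqP (nth 0 u (k + j - (size w - i))) (nth 0 u q).
  by move: le_q; rewrite -subn_eq0 => /eqP ->; rewrite addn0.
move=> _; have lt_pq : k + j - (size w - i) < q.
  rewrite ltn_neqAle; apply/andP; split; last by rewrite /q; lia.
  by apply: contraTneq lt_q => ->; rewrite ltnn.
have -> : k + j = size w - size u + q by rewrite /q; lia.
have lt_qu : q < size u by rewrite /q; lia.
apply: leq_trans (dom q lt_qu).
by apply: (inc_dec_after_descent idu lt_pq _ lt_q); rewrite /q; lia.
Qed.

(** Lowering creates no embedding, so it suffices that the final one survives and that no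
    subtraction truncates; both follow from [bound]. *)
Lemma lower_wordK w : inS u w -> ends_above u i w ->
  [/\ inS u (lower_word w), lift_word (lower_word w) = w &
      posword u -> posword w -> posword (lower_word w)].
Proof.
move=> /inSP[/emb_atP[le_w dom] uniq_w] /ends_aboveP[_ domi].
have sz : size (lower_word w) = size w by rewrite size_mkseq.
have nth_lower p : p < size w ->
    nth 0 (lower_word w) p = nth 0 w p - deficit (size w) p.
  by move=> lt_p; rewrite nth_mkseq.
have def0 p : p < size w - i -> deficit (size w) p = 0.
  by rewrite /deficit => ->.
(* On the last [i] positions the left side is the maximum of the two letters of [u] that the letter
   of [w] dominates. *)
have bound j : j < size u ->
    nth 0 u j + deficit (size w) (size w - size u + j)
      <= nth 0 w (size w - size u + j).
  move=> lt_j; have := dom j lt_j; rewrite /deficit.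
  case: ltnP => [_|le_j]; first by rewrite addn0.
  have := domi (size w - size u + j - (size w - i)).
  rewrite subnKC // addKn; lia.
have def_le p : p < size w -> deficit (size w) p <= nth 0 w p.
  move=> lt_p; have [lt_pi|le_ip] := ltnP p (size w - i); first by rewrite def0.
  have -> : p = size w - size u + (p - (size w - size u)) by lia.
  by apply: leq_trans (bound _ _); [apply: leq_addl | lia].
split.
- apply/inSP; rewrite sz; split.
    apply/emb_atP; rewrite sz; split=> // j lt_j.
    rewrite nth_lower; last by lia.
    by have := bound j lt_j; lia.
  move=> k /emb_atP[]; rewrite sz => le_k domk; apply: uniq_w.
  apply/emb_atP; split=> // j lt_j; apply: leq_trans (domk j lt_j) _.
  by rewrite nth_lower ?leq_subr //; lia.
- apply: (eq_from_nth (x0 := 0)); rewrite size_mkseq // sz => p lt_p.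
  by rewrite nth_lift_word sz // nth_lower // subnK // def_le.
- move=> /posword_nth pos_u /posword_nth pos_w.
  apply/posword_nth => p; rewrite sz => lt_p; rewrite nth_lower //.
  have [lt_pi|le_ip] := ltnP p (size w - i); first by rewrite def0 // subn0 pos_w.
  have eq_p : p = size w - size u + (p - (size w - size u)) by lia.
  have lt_q : p - (size w - size u) < size u by lia.
  have := bound _ lt_q; have := pos_u _ lt_q; rewrite -eq_p; lia.
Qed.

Lemma lift_word_inj : injective lift_word.
Proof.
move=> w w' eqw.
have sz : size w = size w' by have := congr1 size eqw; rewrite !size_mkseq.
apply: (eq_from_nth (x0 := 0)) => // p lt_p.
have := congr1 (nth 0 ^~ p) eqw.
by rewrite /= !nth_lift_word -?sz // => /addIn.
Qed.

End Lifting.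

(** Coefficient form of S_i = x^(d_i) S: lifting is a bijection with inverse [lower_word], keeping
    the length and adding d_i to the sum. *)
Lemma count_inS_ends_above u i m s :
  posword u -> inc_dec u -> i <= size u ->
  count (fun w => inS u w && ends_above u i w) (words m (s + dstat u i)) =
  count (inS u) (words m s).
Proof.
move=> pos_u idu le_i; rewrite -!size_filter -[RHS](size_map (lift_word u i)).
apply: perm_size; apply: uniq_perm.
- exact/filter_uniq/words_uniq.
- rewrite map_inj_uniq; first exact/filter_uniq/words_uniq.
  exact: lift_word_inj.
have size_inS w : inS u w -> size u <= size w.
  by case/inSP=> /emb_atP[le_w _] _; lia.
move=> w; rewrite mem_filter mem_words; apply/andP/mapP.
  case=> /andP[uw ew] /and3P[/eqP sz pos /eqP sum].
  have [uw' liftK pos'] := lower_wordK le_i uw ew.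
  exists (lower_word u i w); last by rewrite liftK.
  rewrite mem_filter uw' mem_words pos' // size_mkseq sz eqxx /=.
  have := sumn_lift_word le_i (size_inS _ uw'); rewrite liftK sum.
  by move/addIn ->.
case=> v; rewrite mem_filter mem_words => /andP[uv].
move=> /and3P[/eqP sz /posword_nth pos /eqP sum] ->.
rewrite inS_lift_word //; split=> //; rewrite size_mkseq sz eqxx /=.
rewrite sumn_lift_word ?size_inS // sum eqxx andbT.
apply/posword_nth=> p; rewrite size_mkseq => lt_p.
by rewrite nth_lift_word // addn_gt0 pos.
Qed.

(** The coefficients of S_i below x^(d_i): every word counted by S_i is a lifted one, so its sum is
    at least d_i. *)
Lemma count_inS_ends_above_small u i m s :
  i <= size u -> s < dstat u i ->
  count (fun w => inS u w && ends_above u i w) (words m s) = 0.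
Proof.
move=> le_i lt_s; apply/eqP; rewrite -leqn0 leqNgt -has_count.
apply/hasP=> -[w]; rewrite mem_words => /and3P[_ _ /eqP sum] /andP[uw ew].
have [uw' liftK _] := lower_wordK le_i uw ew.
have le_w : size u <= size (lower_word u i w).
  by case/inSP: uw' => /emb_atP[le_w _] _; lia.
by have := sumn_lift_word le_i le_w; rewrite liftK sum; lia.
Qed.

Local Open Scope ring_scope.

(** * Congruence of truncated bivariate series *)

Section TruncatedSeries.

Variables M K : nat.

(** Congruence modulo the ideal generated by t^(M+1) and x^(K+1); the outer index is the power of t,
    the inner one that of x. *)
Definition eq_trunc (p q : {poly {poly int}}) : Prop :=
  forall i j, (i <= M)%N -> (j <= K)%N -> p`_i`_j = q`_i`_j.

Local Notation "p =t q" := (eq_trunc p q) (at level 70).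

Lemma eqt_refl p : p =t p. Proof. by []. Qed.

Lemma eq_eqt p q : p = q -> p =t q. Proof. by move->. Qed.

Lemma eqt_sym p q : p =t q -> q =t p.
Proof. by move=> pq i j iM jK; rewrite pq. Qed.

Lemma eqt_trans q p r : p =t q -> q =t r -> p =t r.
Proof. by move=> pq qr i j iM jK; rewrite pq // qr. Qed.

Lemma eqtD p q p' q' : p =t q -> p' =t q' -> p + p' =t q + q'.
Proof. by move=> pq pq' i j iM jK; rewrite !coefD pq // pq'. Qed.

Lemma eqtB p q p' q' : p =t q -> p' =t q' -> p - p' =t q - q'.
Proof. by move=> pq pq' i j iM jK; rewrite !coefB pq // pq'. Qed.

Lemma eqtMl r p q : p =t q -> r * p =t r * q.
Proof.
move=> pq i j iM jK; rewrite !coefM !coef_sum; apply: eq_bigr => a _.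
rewrite !coefM; apply: eq_bigr => b _; congr (_ * _).
by rewrite pq // (leq_trans (leq_subr _ _)).
Qed.

Lemma eqtMr r p q : p =t q -> p * r =t q * r.
Proof. by move=> pq; rewrite !(mulrC _ r); apply: eqtMl. Qed.

Lemma eqt_sum (I : eqType) (r : seq I) (F G : I -> {poly {poly int}}) :
  (forall i, i \in r -> F i =t G i) -> \sum_(i <- r) F i =t \sum_(i <- r) G i.
Proof.
move=> FG; rewrite !big_seq.
by apply: (big_ind2 eq_trunc) => // *; apply: eqtD.
Qed.

Lemma coef_xVXM k p i : (xV ^+ k * p)`_i = 'X^k * p`_i.
Proof. by rewrite /xV -polyC_exp coefCM. Qed.

Lemma xVX_eqt0 k : (K < k)%N -> xV ^+ k =t 0.
Proof.
move=> lt_Kk i j _ jK; rewrite -[xV ^+ k]mulr1 coef_xVXM coefXnM !coef0.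
by rewrite (leq_ltn_trans jK lt_Kk).
Qed.

(* [1 - x] is invertible modulo [x ^ (K + 1)]. *)
Lemma eqt_cancel p q : (1 - xV) * p =t (1 - xV) * q -> p =t q.
Proof.
pose h : {poly {poly int}} := \sum_(i < K.+1) xV ^+ i.
have hE : (1 - xV) * h = 1 - xV ^+ K.+1.
  rewrite -[in RHS](expr1n _ K.+1) subrXX; congr (_ * _).
  by apply: eq_bigr => i _; rewrite expr1n mul1r.
have inv r : h * ((1 - xV) * r) =t r.
  rewrite mulrA (mulrC h) hE mulrBl mul1r -[X in _ =t X]subr0.
  apply: eqtB => //.
  by rewrite -[X in _ =t X](mul0r r); apply/eqtMr/xVX_eqt0.
move=> /(eqtMl h) pq.
exact: eqt_trans (eqt_sym (inv p)) (eqt_trans pq (inv q)).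
Qed.

(** * Generating functions of sets of words *)

Definition wordsum (P : pred (seq nat)) (m : nat) : {poly int} :=
  \sum_(w <- allwords m K | P w) 'X^(sumn w).

Definition genfun (P : pred (seq nat)) : {poly {poly int}} :=
  \poly_(m < M.+1) wordsum P m.

Lemma coef_genfun P m : (m <= M)%N -> (genfun P)`_m = wordsum P m.
Proof. by move=> le_m; rewrite coef_poly ltnS le_m. Qed.

Lemma coef_wordsum P m s : (s <= K)%N -> (wordsum P m)`_s = (count P (words m s))%:Z.
Proof.
move=> le_s; rewrite coef_sum -sum1_count -(perm_big _ (perm_words m le_s)) /=.
rewrite big_filter_cond -natz natr_sum big_mkcond [RHS]big_mkcond /=.
apply: eq_bigr => w _; rewrite coefXn [s == _]eq_sym.
by case: (P w); case: eqP.
Qed.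

Lemma eq_genfun P Q : P =1 Q -> genfun P = genfun Q.
Proof.
by move=> PQ; apply/polyP=> i; rewrite !coef_poly /wordsum (eq_bigl _ _ PQ).
Qed.

Lemma big_allwords_cons m (F : seq nat -> {poly int}) :
  \sum_(w <- allwords m.+1 K) F w =
  \sum_(a <- iota 1 K) \sum_(w <- allwords m K) F (a :: w).
Proof. exact: big_allpairs_dep. Qed.

(** [allwords] builds words by prepending letters, whereas the recurrences append them. *)
Lemma big_allwords_rcons m (F : seq nat -> {poly int}) :
  \sum_(w <- allwords m.+1 K) F w =
  \sum_(w <- allwords m K) \sum_(a <- iota 1 K) F (rcons w a).
Proof.
elim: m F => [|m IHm] F; rewrite big_allwords_cons.
  by rewrite big_seq1; apply: eq_bigr => a _; rewrite big_seq1.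
by rewrite big_allwords_cons; apply: eq_bigr => a _; rewrite IHm.
Qed.

Definition lettersum (c : nat) : {poly int} := \sum_(a <- iota 1 K | (c <= a)%N) 'X^a.

Lemma lettersumE c : (0 < c)%N -> (1 - xV) * (lettersum c)%:P =t xV ^+ c.
Proof.
(* The exact telescoped geometric sum; [minn] accounts for [c > K], where the sum is empty. *)
move=> c_gt0; suff ->: (1 - xV) * (lettersum c)%:P = xV ^+ minn c K.+1 - xV ^+ K.+1.
  rewrite -[X in _ =t X]subr0; apply: eqtB; last exact: xVX_eqt0.
  case: (leqP c K.+1) => // /ltnW lt_c.
  apply: eqt_trans (xVX_eqt0 _) (eqt_sym (xVX_eqt0 _)) => //.
rewrite /lettersum /xV -!polyC_exp -polyCB -polyC1 -polyCB -polyCM.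
congr _%:P; rewrite ?polyC1.
elim: K => [|k IHk]; first by rewrite big_nil mulr0 (minn_idPr c_gt0) subrr.
have -> : iota 1 k.+1 = iota 1 k ++ [:: k.+1] by rewrite -[in LHS](addn1 k) iotaD.
rewrite big_cat /= mulrDr IHk big_cons big_nil.
have [le_c|lt_c] := leqP c k.+1.
  by rewrite (minn_idPl (leqW le_c)) (exprS _ k.+1); ring.
by rewrite (minn_idPr lt_c) !subrr mulr0 addr0.
Qed.

Lemma wordsum_rcons (Q P1 P2 : pred (seq nat)) c m :
  (forall w a, (0 < a)%N -> Q w && (c <= a)%N = P1 (rcons w a) || P2 (rcons w a)) ->
  (forall w, ~~ (P1 w && P2 w)) ->
  wordsum Q m * lettersum c = wordsum P1 m.+1 + wordsum P2 m.+1.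
Proof.
move=> QP disj; rewrite /wordsum [X in _ = X + _]big_mkcond [X in _ = _ + X]big_mkcond.
rewrite -big_split /= big_allwords_rcons mulr_suml big_mkcond.
apply: eq_bigr => w _.
transitivity (\sum_(a <- iota 1 K)
  (if Q w && (c <= a)%N then 'X^(sumn (rcons w a)) else 0 : {poly int})).
  case: (Q w); last by rewrite big1.
  rewrite /lettersum mulr_sumr big_mkcond; apply: eq_bigr => a _ /=.
  by rewrite sumn_rcons exprD.
rewrite !big_seq; apply: eq_bigr => a; rewrite mem_iota => /andP[a_gt0 _].
rewrite QP //; have := disj (rcons w a).
by case: (P1 _); case: (P2 _); rewrite //= ?addr0 ?add0r.
Qed.

(** Common source of both recurrences. The factor [1 - xV] clears the geometric series of the
    appended letter; the empty word, which arises from no appending, is subtracted. *)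
Lemma genfun_rcons (Q P1 P2 : pred (seq nat)) c :
  (0 < c)%N ->
  (forall w a, (0 < a)%N -> Q w && (c <= a)%N = P1 (rcons w a) || P2 (rcons w a)) ->
  (forall w, ~~ (P1 w && P2 w)) ->
  tV * xV ^+ c * genfun Q =t
  (1 - xV) * (genfun P1 + genfun P2 - (P1 [::] || P2 [::])%:R).
Proof.
move=> c_gt0 QP disj.
suff step : tV * ((lettersum c)%:P * genfun Q) =t
    genfun P1 + genfun P2 - (P1 [::] || P2 [::])%:R.
  apply: eqt_trans (eqtMl _ step).
  rewrite mulrCA mulrA -!mulrA; apply: eqtMl; rewrite mulrA.
  exact/eqtMr/eqt_sym/lettersumE.
move=> i j iM jK; rewrite /tV coefXM !coefD !coefN !coef_genfun //.
case: i iM => [|i] iM /=.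
  rewrite coef0 /wordsum !big_cons !big_nil /= expr0; have := disj [::].
  by case: (P1 _); case: (P2 _);
    rewrite //= ?addr0 ?coef1 /= ?coef1 ?coef0 ?coef0 ?add0r ?addr0 ?subrr ?oppr0.
rewrite -polyC_natr coefC /= coef0 subr0 coefCM coef_genfun 1?ltnW //.
by rewrite mulrC (wordsum_rcons _ QP) // coefD.
Qed.

Lemma genfun_inS_ends_above u i :
  posword u -> inc_dec u -> (i <= size u)%N ->
  genfun (fun w => inS u w && ends_above u i w) =t
  xV ^+ dstat u i * genfun (inS u).
Proof.
move=> pos_u idu le_i m s mM sK.
rewrite coef_xVXM !coef_genfun // coefXnM coef_wordsum //.
case: ltnP => [lt_s|le_d]; first by rewrite count_inS_ends_above_small.
rewrite coef_wordsum; last by apply: leq_trans sK; apply: leq_subr.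
by rewrite -(@count_inS_ends_above u i m) // subnK.
Qed.

(** * Equations relating A and S, and elimination of A *)

Section Word.

Variable u : seq nat.
Hypotheses (u_gt0 : (0 < size u)%N) (pos_u : posword u) (idu : inc_dec u).

Local Notation A := (genfun (fun w => ~~ gfo u w)).
Local Notation S := (genfun (inS u)).
Local Notation A_ k := (genfun (fun w => ~~ gfo u w && ends_above u k w)).
Local Notation S_ k := (genfun (fun w => inS u w && ends_above u k w)).

Lemma avoid_inS_disjoint w : ~~ (~~ gfo u w && inS u w).
Proof. by rewrite /inS; case: (gfo u w). Qed.

Lemma avoid_rcons w a : ~~ gfo u w = ~~ gfo u (rcons w a) || inS u (rcons w a).
Proof.
rewrite inS_rcons //; case uw: (gfo u w); first by rewrite gfo_rcons.
by case: (gfo u _).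
Qed.

Lemma avoid_eqt : tV * xV * A =t (1 - xV) * (A + S - 1).
Proof.
have := @genfun_rcons (fun w => ~~ gfo u w) (fun w => ~~ gfo u w) (inS u) 1 isT.
have -> : ~~ gfo u [::] || inS u [::].
  suff -> : gfo u [::] = false by [].
  by apply/gfoP=> -[k /emb_atP[/= le_k _]]; lia.
by apply=> [w a a_gt0|]; [rewrite a_gt0 andbT -avoid_rcons | exact: avoid_inS_disjoint].
Qed.

Lemma avoid_ends_above_eqt k : (k < size u)%N ->
  tV * xV ^+ nth 0%N u k * A_ k =t (1 - xV) * (A_ k.+1 + S_ k.+1).
Proof.
move=> lt_k; have uk_gt0 : (0 < nth 0 u k)%N by exact: (all_nthP 0%N pos_u).
have := @genfun_rcons (fun w => ~~ gfo u w && ends_above u k w)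
  (fun w => ~~ gfo u w && ends_above u k.+1 w)
  (fun w => inS u w && ends_above u k.+1 w) _ uk_gt0.
rewrite ends_above_nil // !andbF subr0; apply=> [w a _|w].
  by rewrite ends_above_rcons // (avoid_rcons w a) -!andb_orl andbA.
have := avoid_inS_disjoint w.
by case: (gfo u w); case: (inS u w); rewrite //= !andbF.
Qed.

(** Iterates [avoid_ends_above_eqt] from A_0 = A. The term S_i, split off at step [i], is then
    multiplied by the weights of the prefix letters after the [i]-th. *)
Lemma avoid_prefix_eqt k : (k <= size u)%N ->
  tV ^+ k * xV ^+ sumn (take k u) * A =t
  (1 - xV) ^+ k * A_ k +
  \sum_(1 <= i < k.+1)
    tV ^+ (k - i) * xV ^+ sumn (drop i (take k u)) * (1 - xV) ^+ i * S_ i.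
Proof.
elim: k => [|k IHk] lt_k.
  rewrite take0 !expr0 !mul1r big_nil addr0.
  by rewrite (eq_genfun (Q := fun w => ~~ gfo u w && ends_above u 0 w)) // => w;
    rewrite ends_above0 andbT.
rewrite (take_nth 0%N) // sumn_rcons exprS exprD.
have -> : tV * tV ^+ k * (xV ^+ sumn (take k u) * xV ^+ nth 0%N u k) * A =
  tV * xV ^+ nth 0%N u k * (tV ^+ k * xV ^+ sumn (take k u) * A) by ring.
apply: eqt_trans (eqtMl _ (IHk (ltnW lt_k))) _.
rewrite mulrDr [X in _ =t _ + X]big_nat_recr //= subnn.
have -> : drop k.+1 (rcons (take k u) (nth 0%N u k)) = [::].
  by rewrite drop_oversize // size_rcons size_take lt_k.
rewrite [sumn [::]]/= !expr0 !mul1r mulr_sumr.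
have -> : \sum_(1 <= i < k.+1) tV * xV ^+ nth 0%N u k *
      (tV ^+ (k - i) * xV ^+ sumn (drop i (take k u)) * (1 - xV) ^+ i * S_ i) =
    \sum_(1 <= i < k.+1) tV ^+ (k.+1 - i) *
      xV ^+ sumn (drop i (rcons (take k u) (nth 0%N u k))) * (1 - xV) ^+ i * S_ i.
  rewrite !big_nat; apply: eq_bigr => i /andP[_ le_i].
  rewrite subSn // exprS drop_rcons; last by rewrite size_take lt_k.
  by rewrite sumn_rcons exprD; ring.
rewrite [X in _ =t _ + X]addrC addrA; apply: eqtD => //.
rewrite -mulrDr exprSr -[X in _ =t X]mulrA mulrCA.
by apply: eqtMl; apply: avoid_ends_above_eqt.
Qed.

Lemma avoid_word_eqt :
  Npoly u * A =t
  (1 - xV) * (\sum_(1 <= i < (size u).+1)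
    tV ^+ (size u - i) * xV ^+ (dstat u i + sumn (drop i u)) * (1 - xV) ^+ i.-1) * S.
Proof.
have := avoid_prefix_eqt (leqnn _); rewrite take_size.
have -> : A_ (size u) = 0.
  apply/polyP=> i; rewrite coef_poly coef0 /wordsum big1 ?if_same // => w.
  by case/andP=> /negP no_u /ends_above_size /no_u.
rewrite mulr0 add0r => /eqt_trans; apply.
rewrite mulr_sumr mulr_suml; apply: eqt_sum => i.
rewrite mem_index_iota => /andP[i_gt0 le_i].
apply: eqt_trans (eqtMl _ (genfun_inS_ends_above pos_u idu le_i)) _.
(* One factor [1 - xV] is pulled out of the power, leaving the exponent [i.-1] of [Dpoly]. *)
by rewrite -[in (1 - xV) ^+ i](prednK i_gt0) exprS exprD; apply: eq_eqt; ring.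
Qed.

Lemma genfun_inS_eqt : S * Dpoly u =t Npoly u.
Proof.
(* The extra factor [1 - xV] makes [(1 - xV) * T * S] appear, which [avoid_word_eqt] trades for
   [Npoly u * A]. *)
apply: eqt_cancel; rewrite /Dpoly; set T := \sum_(1 <= i < _) _.
have ASN := avoid_word_eqt; rewrite -/T in ASN.
have -> : (1 - xV) * (S * (Npoly u + (1 - xV - tV * xV) * T)) =
  (1 - xV) * S * Npoly u + (1 - xV - tV * xV) * ((1 - xV) * T * S) by ring.
apply: eqt_trans (eqtD (eqt_refl _) (eqtMl _ (eqt_sym ASN))) _.
(* Regrouped as N ((1 - x)(S + A) - t x A), where [avoid_eqt] reduces the second factor to 1 - x. *)
have -> : (1 - xV) * S * Npoly u + (1 - xV - tV * xV) * (Npoly u * A) =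
  Npoly u * ((1 - xV) * (S + A)) + (- Npoly u) * (tV * xV * A) by ring.
apply: eqt_trans (eqtD (eqt_refl _) (eqtMl _ avoid_eqt)) _.
by apply: eq_eqt; ring.
Qed.

End Word.

End TruncatedSeries.

(* S(u;t,x) = N / D as formal power series, stated as S * D = N coefficientwise
   (D has constant term 1, so this is equivalent); the coefficient of t^m x^s
   in a bivariate poly p is (p`_m)`_s. *)
Theorem theorem1 (u : seq nat) :
  posword u -> inc_dec u ->
  forall m s : nat,
    \sum_(i < m.+1) \sum_(j < s.+1)
       (Scoef u i j)%:Z * ((Dpoly u)`_(m - i))`_(s - j)
    = ((Npoly u)`_m)`_s.
Proof.
move=> pos_u idu m s.
(* Truncating at [M = m] and [K = s] loses nothing that contributes to this coefficient. *)
transitivity ((genfun m s (inS u) * Dpoly u)`_m`_s).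
  rewrite coefM coef_sum; apply: eq_bigr => i _; rewrite coefM.
  apply: eq_bigr => j _.
  by rewrite coef_genfun -1?ltnS // coef_wordsum -1?ltnS.
have [u0|u_gt0] := posnP (size u); last exact: (genfun_inS_eqt u_gt0 pos_u idu).
(* For empty [u] the sum in [Dpoly] is empty, so N = D = 1 and S must be 1. *)
move/size0nil: u0 => ->.
rewrite /Dpoly /Npoly /= big_nil mulr0 addr0 !expr0 !mulr1.
rewrite coef_genfun // coef_wordsum // coef1.
(* The empty word embeds at position 0, which is the final position only in the empty word. *)
have inS_nil w : inS [::] w = (w == [::]).
  apply/inSP/eqP=> [[_ uniq_w]|->]; last by split=> // k /emb_atP[] /=; lia.
  have : emb_at [::] w 0 by apply/emb_atP.
  by move/uniq_w => /= /esym/eqP; rewrite subn0 size_eq0 => /eqP.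
rewrite (eq_count inS_nil) count_uniq_mem ?words_uniq // mem_words /=.
by rewrite eq_sym; case: m => [|m] /=; rewrite ?coef1 ?coef0 // eq_sym; case: eqP.
Qed.
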